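(* There are two nonisomorphic nonorientable regular embeddings $\mathcal{M}$ and $\mathcal{N}$ of the Hamming graph $H(2,6)$ which form a Petrie dual pair (each is the Petrie dual of the other). They have genera $110$ and $101$, and types $\{10,10\}_8$ and $\{8,10\}_{10}$, respectively. The automorphism group of each of them is isomorphic to $PGL_2(9)$.
   Context: The Hamming graph $H(d,n)$ has vertex set $\{0,1,\dots,n-1\}^d$, with two vertices adjacent if and only if they differ in exactly one coordinate. A map is a 2-cell embedding of a connected graph $K$, with edge set $E$, in a compact connected surface $S$ without boundary. Its flags are its mutually incident vertex-edge-face triples, understood topologically, i.e. the $4|E|$ triangles of the barycentric subdivision of the map (each edge lies in exactly 4 flags). An automorphism of a map is a permutation of its flags that preserves the three relations of differing only in the vertex, only in the edge, or only in the face. The map is regular if its automorphism group acts regularly on flags (equivalently, has order $4|E|$). A regular embedding of $K$ is an embedding of $K$ that gives a regular map; it is nonorientable if $S$ is nonorientable. The genus of a nonorientable map is $2-\chi$, where $\chi$ is the Euler characteristic of $S$. Two embeddings of $K$ are isomorphic if there is a homeomorphism between the underlying surfaces that maps the embedded graph onto the embedded graph (inducing a graph isomorphism). For a flag $(v,e,f)$ of a regular map let $\lambda,\rho,\tau$ be the automorphisms sending it to the flag adjacent to it differing only in $v$, only in $e$, only in $f$ respectively. These generate the automorphism group, and the map (determined up to isomorphism by the group and the triple) is denoted $\mathcal{M}(\lambda,\rho,\tau)$. The Petrie dual of $\mathcal{M}(\lambda,\rho,\tau)$ is $\mathcal{M}(\lambda\tau,\rho,\tau)$: it has the same underlying graph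 and automorphism group, and its faces are bounded by the Petrie polygons (closed zig-zag walks turning alternately first left and first right) of the original map. A regular map has type $\{p,q\}_r$ if $p$ is its covalency (the number of sides of each face), $q$ is the valency of each vertex, and $r$ is its Petrie length (the length of each Petrie polygon); equivalently $p,q,r$ are the orders of $\lambda\rho$, $\rho\tau$ and $\lambda\rho\tau$. *)

(* Defs.v *)
From HB Require Import structures.
From mathcomp Require Import all_boot all_order all_algebra.
From mathcomp Require Import all_fingroup all_solvable.

Set Implicit Arguments.
Unset Strict Implicit.
Unset Printing Implicit Defensive.

(* A simple graph is given by a symmetric irreflexive relation on a finType. *)

Definition hamming (d n : nat) : rel {ffun 'I_d -> 'I_n} :=
  fun u v => #|[set i | u i != v i]| == 1.

(* A map on a compact connected surface without boundary, with at least one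
   edge, given by its set of flags (the triangles of the barycentric
   subdivision) and the three gluing involutions: [chv x], [che x], [chf x] is
   the flag differing from [x] only in its vertex, edge, face.  Freeness of the
   three involutions expresses the absence of boundary; freeness of [chv \o chf]
   together with its commutation says that each edge lies in exactly 4 flags. *)
Record surfmap := Surfmap {
  flag : finType;
  chv : flag -> flag;
  che : flag -> flag;
  chf : flag -> flag;
  chvK : involutive chv;
  cheK : involutive che;
  chfK : involutive chf;
  chv_free : forall x, chv x != x;
  che_free : forall x, che x != x;
  chf_free : forall x, chf x != x;
  chvf_comm : forall x, chv (chf x) = chf (chv x);
  chvf_free : forall x, chv (chf x) != x;
  flag_nonempty : (0 < #|flag|)%N;
  flag_connected : forall x y,
    connect [rel u v | [|| v == chv u, v == che u | v == chf u]] x y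
}.

Section MapNotions.
Variable M : surfmap.
Implicit Types x y : flag M.

(* A vertex, edge or face of the map is the set of flags that contain it. *)
Definition vertex_of x : {set flag M} :=
  [set y | connect [rel u v | (v == che u) || (v == chf u)] x y].
Definition edge_of x : {set flag M} :=
  [set y | connect [rel u v | (v == chv u) || (v == chf u)] x y].
Definition face_of x : {set flag M} :=
  [set y | connect [rel u v | (v == chv u) || (v == che u)] x y].

Definition vertices : {set {set flag M}} := [set vertex_of x | x : flag M].
Definition edges : {set {set flag M}} := [set edge_of x | x : flag M].
Definition faces : {set {set flag M}} := [set face_of x | x : flag M].

Definition euler_char : int :=
  (#|vertices|%:Z - #|edges|%:Z + #|faces|%:Z)%R.

(* The surface is orientable iff its triangles can be oriented coherently,
   i.e. adjacent flags receive opposite signs. *)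
Definition orientable : Prop :=
  exists c : flag M -> bool, forall x,
    [/\ c (chv x) = ~~ c x, c (che x) = ~~ c x & c (chf x) = ~~ c x].

Definition nonorientable : Prop := ~ orientable.

Definition nonorientable_genus : int := (2 - euler_char)%R.

(* The embedded graph is isomorphic to [adj]: [lab] names the vertex of each
   flag, bijectively on vertices, and sending an edge to its set of end
   vertices is a bijection from [edges] to the edges of [adj]. *)
Definition embeds (V : finType) (adj : rel V) : Prop :=
  exists lab : flag M -> V,
    [/\ forall v, exists x, lab x = v,
        forall x y, lab x = lab y <-> vertex_of x = vertex_of y,
        forall x, adj (lab x) (lab (chv x)),
        forall u v, adj u v -> exists x, lab x = u /\ lab (chv x) = v
      & forall x y,
          [set lab x; lab (chv x)] = [set lab y; lab (chv y)] ->
          edge_of x = edge_of y].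

Definition map_aut : {set {perm flag M}} :=
  [set s : {perm flag M} | [forall x,
     [&& s (chv x) == chv (s x), s (che x) == che (s x)
       & s (chf x) == chf (s x)]]].

Lemma map_aut_group_set : group_set map_aut.
Proof.
apply/group_setP; split.
  by rewrite inE; apply/forallP => x; rewrite !perm1 !eqxx.
move=> s t; rewrite !inE => /forallP Hs /forallP Ht; apply/forallP => x.
rewrite !permM; have /and3P[/eqP -> /eqP -> /eqP ->] := Hs x.
exact: Ht (s x).
Qed.
Canonical map_aut_group := Group map_aut_group_set.

Definition regular_map : Prop :=
  [transitive map_aut, on [set: flag M] | 'P] /\
  (forall x, 'C_(map_aut)[x | 'P] = 1)%g.

(* The number of sides of the face at [x], the valency of the vertex at [x], and
   the length of the Petrie polygon through [x], as the number of steps after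
   which the corresponding walk returns to its starting flag: along a face take
   the next edge and go to its other end; along a Petrie polygon change also the
   side of the edge at each step. *)
Definition covalency x : nat := fingraph.order (fun y => chv (che y)) x.
Definition valency x : nat := fingraph.order (fun y => chf (che y)) x.
Definition petrie_length x : nat := fingraph.order (fun y => chv (chf (che y))) x.

Definition has_type (p q r : nat) : Prop :=
  forall x, [/\ covalency x = p, valency x = q & petrie_length x = r].

Definition flag_triple x (l r t : {perm flag M}) : Prop :=
  [/\ l \in map_aut, r \in map_aut & t \in map_aut] /\
  [/\ l x = chv x, r x = che x & t x = chf x].

(* [M] is the map M(l, r, t) determined by the group [G] and the triple. *)
Definition is_map_of (gT : finGroupType) (G : {set gT}) (l r t : gT) : Prop :=
  regular_map /\
  exists x l' r' t' (phi : {morphism map_aut >-> gT}),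
    [/\ flag_triple x l' r' t', isom map_aut G phi
      & [/\ phi l' = l, phi r' = r & phi t' = t]].

End MapNotions.

Definition regular_embedding (V : finType) (adj : rel V) (M : surfmap) : Prop :=
  embeds M adj /\ regular_map M.

Definition map_iso (M N : surfmap) : Prop :=
  exists f : flag M -> flag N,
    bijective f /\
    forall x, [/\ f (chv x) = chv (f x), f (che x) = che (f x)
                & f (chf x) = chf (f x)].

(* [N] is the Petrie dual of [M]: if [M] = M(l, r, t) then [N] = M(lt, r, t). *)
Definition is_petrie_dual (M N : surfmap) : Prop :=
  regular_map M /\
  exists x (l r t : {perm flag M}),
    flag_triple x l r t /\ is_map_of N (map_aut M) (l * t)%g r t.

Definition PGL (n : nat) (F : finFieldType) :=
  ('GL_n[F] / 'Z('GL_n[F]))%g.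

(* Main.v *)
Require Import Defs.
From HB Require Import structures.
From mathcomp Require Import all_boot all_order all_algebra.
From mathcomp Require Import all_fingroup all_solvable.
From mathcomp Require Import finfield ring.

Set Implicit Arguments.
Unset Strict Implicit.
Unset Printing Implicit Defensive.

(** Both maps are Cayley maps of PGL(2, 9).  Write the field with 9 elements as
    F_3[i] with i^2 = -1, and let L, R, T be the classes of the matrices

      [0 1; 1 0],   [1 i; 1 -1],   [0 1; -1 0].

    They are involutions, they generate PGL(2, 9), and L commutes with T.  Take
    the 720 group elements as flags, and let left multiplication by L, R, T
    change the vertex, the edge, the face.  Right multiplications commute with
    left ones, so they are automorphisms, and they carry the flag 1 to every
    other flag: the map is regular ([flag_triple_regular], [regular_map10]).
    In a regular map all flags look alike, so the type and the number of
    vertices, edges and faces are read off at the flag 1 ([regular_has_type],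
    [regular_counts]).  There L R and R T have order 10 and L R T has order 8;
    the vertices, edges and faces are the right cosets of the dihedral groups
    of order 20, 4 and 20 generated by two of L, R, T, which gives the Euler
    characteristic 36 - 180 + 36 = -108.

    The graph is found from PSL(2, 9), which is isomorphic to A_6.  That group
    has two conjugacy classes of six subgroups A_5, its two kinds of point
    stabilisers, and the elements of PGL(2, 9) outside PSL(2, 9) exchange the
    two classes.  So PGL(2, 9) permutes six rows and six columns of a 6 x 6 grid
    and may exchange rows with columns.  The group generated by R and T is the
    stabiliser of one cell, hence vertices correspond to cells, that is, to the
    vertices of H(2, 6), and L moves that cell to another one in the same row.
    A flag is recorded as a permutation of these 12 lines together with a
    normalised matrix: the permutation shows the vertex, the matrix shows the
    element of PGL(2, 9).

    Replacing L by L T, which is the Petrie dual, changes neither vertices nor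
    edges nor automorphisms, so regularity and the embedded graph carry over
    ([regular_petrie], [embeds_petrie]) and only the faces have to be counted
    again: they now have 8 sides, and 36 - 180 + 45 = -99.  The two maps have
    faces of different length, so they are not isomorphic.  In each of them a
    closed walk through an odd number of flags excludes an orientation.

    Finally, every field F of order 9 contains a square root of -1
    ([exists_sqrtN1]), so the matrices can be read in F.  This gives a map from
    flags to PGL(2, F) that turns flag changes into left multiplications;
    evaluating it at the image of the flag 1 embeds the automorphism group into
    PGL(2, F), and the orders agree ([map_aut_isog], [card_PGL]). *)

(** * Orbits and cycles of permutations of a finite set *)

Lemma connect_closed (T : finType) (e : rel T) (P : T -> Prop) x :
    P x -> (forall y z, P y -> e y z -> P z) ->
  forall y, connect e x y -> P y.
Proof.
move=> Px Pe y /connectP [p + ->].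
elim: p x Px => //= z p IH x Px /andP [exz]; exact/IH/(Pe x).
Qed.

Lemma order_eq_traject (T : finType) (f : T -> T) x n :
  0 < n -> iter n f x = x -> uniq (traject f x n) -> fingraph.order f x = n.
Proof.
case: n => // n _ fnx Ut; rewrite -[RHS](size_traject f x).
apply: (order_cycle _ Ut); last by rewrite mem_head.
rewrite [path.cycle _ _]/=.
have <- : traject f (f x) n.+1 = rcons (traject f (f x) n) x.
  by rewrite trajectSr -iterSr fnx.
exact: fpath_traject.
Qed.

(** [h] maps the [f]-cycle of [x] injectively onto a [g]-cycle. *)
Lemma order_conj (T T' : finType) (h : T -> T') (f : T -> T) (g : T' -> T') x :
    injective h -> injective f -> (forall y, h (f y) = g (h y)) ->
  fingraph.order g (h x) = fingraph.order f x.
Proof.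
move=> inj_h inj_f hfg.
have hiter n : h (iter n f x) = iter n g (h x) by elim: n => //= n <-.
apply: order_eq_traject; first exact: fingraph.order_gt0.
  by rewrite -hiter iter_order.
suff ->: traject g (h x) (fingraph.order f x) = map h (fingraph.orbit f x).
  by rewrite map_inj_uniq ?orbit_uniq.
rewrite /fingraph.orbit; move: (fingraph.order f x) => n.
elim: n {hiter} x => //= n IH x; by rewrite -hfg IH.
Qed.

(** With two of the three flag changes for [a] and [b], this is definitionally a
    vertex, an edge or a face of a map. *)
Definition orbit2 (T : finType) (a b : T -> T) x :=
  [set y | connect [rel u v | (v == a u) || (v == b u)] x y].

Section TwoInvolutions.
Variables (T : finType) (a b : T -> T).
Hypotheses (aK : involutive a) (bK : involutive b).

Let e := [rel u v | (v == a u) || (v == b u)].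

Lemma orbit2_connect_sym : connect_sym e.
Proof.
apply: sym_connect_sym => x y /=.
by rewrite ![y == _]eq_sym (inv_eq aK) (inv_eq bK).
Qed.

Lemma orbit2_ind (P : T -> Prop) x :
    P x -> (forall y, P y -> P (a y)) -> (forall y, P y -> P (b y)) ->
  forall y, y \in orbit2 a b x -> P y.
Proof.
move=> Px Pa Pb y; rewrite inE; apply: connect_closed => // u v Pu /orP.
by case=> /eqP ->; auto.
Qed.

Lemma orbit2_refl x : x \in orbit2 a b x. Proof. by rewrite inE. Qed.

Lemma orbit2_step x y :
  y \in orbit2 a b x -> (a y \in orbit2 a b x) && (b y \in orbit2 a b x).
Proof.
rewrite !inE => xy; apply/andP.
by split; apply: connect_trans xy (connect1 _); rewrite /= eqxx ?orbT.
Qed.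

Lemma orbit2_eq x y : orbit2 a b x = orbit2 a b y <-> y \in orbit2 a b x.
Proof.
split=> [-> | ]; first exact: orbit2_refl.
rewrite inE => xy; apply/setP => z; rewrite !inE.
exact: (same_connect orbit2_connect_sym xy).
Qed.

Lemma orbit2_stepE x :
  orbit2 a b (a x) = orbit2 a b x /\ orbit2 a b (b x) = orbit2 a b x.
Proof.
by have /andP [] := orbit2_step (orbit2_refl x); split; apply/esym/orbit2_eq.
Qed.

Lemma card_orbits2 k : (forall x, #|orbit2 a b x| = k) ->
  (#|[set orbit2 a b x | x : T]| * k)%N = #|T|.
Proof.
move=> card_k; set P := imset _ _.
have partP : partition P [set: T].
  suff ->: P = equivalence_partition (connect e) [set: T].
    apply: equivalence_partitionP => x y z _ _ _; split; first exact: connect0.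
    by move=> xy; apply: (same_connect orbit2_connect_sym).
  rewrite /equivalence_partition.
  apply/setP => A; apply/imsetP/imsetP => [[x _ ->]|[x _ ->]]; exists x => //;
    by apply/setP => y; rewrite !inE.
rewrite -cardsT (card_uniform_partition (n := k) _ partP) // => A.
by case/imsetP=> x _ ->.
Qed.

Lemma orbit2_conj (h : T -> T) x :
    injective h -> (forall y, h (a y) = a (h y)) ->
    (forall y, h (b y) = b (h y)) ->
  #|orbit2 a b (h x)| = #|orbit2 a b x|.
Proof.
move=> inj_h ha hb; rewrite -[RHS](card_imset _ inj_h).
apply: eq_card => y; apply/idP/imsetP => [| [z zx ->]]; last first.
  apply: (orbit2_ind (P := fun z => h z \in orbit2 a b (h x))) zx => [|w|w].
  - exact: orbit2_refl.
  - by rewrite ha; case/orbit2_step/andP.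
  - by rewrite hb; case/orbit2_step/andP.
move: y; apply: (orbit2_ind (P := fun w => exists2 z, z \in orbit2 a b x & w = h z))
  => [|z [w wx ->]|z [w wx ->]].
- by exists x; rewrite ?orbit2_refl.
- by exists (a w); rewrite ?ha //; case/andP: (orbit2_step wx).
- by exists (b w); rewrite ?hb //; case/andP: (orbit2_step wx).
Qed.

(** A labelling that is constant on orbits induces a surjection from the orbits
    to the labels; when both sets have the same size it is injective, so equal
    labels mean equal orbits. *)
Lemma orbit2_separated (V : finType) (lab : T -> V) :
    (forall x, lab (a x) = lab x) -> (forall x, lab (b x) = lab x) ->
    #|[set lab x | x : T]| = #|[set orbit2 a b x | x : T]| ->
  forall x y, lab x = lab y <-> orbit2 a b x = orbit2 a b y.
Proof.
move=> laba labb card_eq.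
have lab_orb x y : y \in orbit2 a b x -> lab y = lab x.
  by apply: (orbit2_ind (P := fun z => lab z = lab x)) => // z; rewrite (laba, labb).
pose g (A : {set T}) := omap lab [pick z in A].
have gE x : g (orbit2 a b x) = Some (lab x).
  rewrite /g; case: pickP => [z /lab_orb /= -> // | /(_ x)].
  by rewrite orbit2_refl.
have g_inj : {in [set orbit2 a b x | x : T] &, injective g}.
  apply/imset_injP; rewrite -card_eq -[eqbRHS](card_imset _ (@Some_inj _)).
  by rewrite -!imset_comp; apply/eqP/eq_card => A; rewrite (eq_imset _ gE).
move=> x y; split=> [eq_lab | /orbit2_eq/lab_orb //].
by apply: g_inj; rewrite ?imset_f // !gE eq_lab.
Qed.

End TwoInvolutions.

(** * Regular maps *)

Section Maps.
Variable M : surfmap.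
Implicit Types x y : flag M.

Lemma flag_ind (P : flag M -> Prop) x :
    P x -> (forall y, P y -> P (chv y)) -> (forall y, P y -> P (che y)) ->
    (forall y, P y -> P (chf y)) ->
  forall y, P y.
Proof.
move=> Px Pv Pe Pf y; apply: connect_closed (flag_connected x y) => // u v Pu.
by case/or3P=> /eqP ->; auto.
Qed.

Lemma map_autP (s : {perm flag M}) :
  reflect (forall x, [/\ s (chv x) = chv (s x), s (che x) = che (s x)
                       & s (chf x) = chf (s x)])
          (s \in map_aut M).
Proof.
rewrite inE; apply: (iffP forallP) => [Hs x | Hs x].
  by have /and3P [/eqP -> /eqP -> /eqP ->] := Hs x.
by have [-> -> ->] := Hs x; rewrite !eqxx.
Qed.

(** An automorphism is determined by its value at one flag because the flag
    graph is connected. *)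
Lemma map_aut_eq (s t : {perm flag M}) x :
  s \in map_aut M -> t \in map_aut M -> s x = t x -> s = t.
Proof.
move=> /map_autP Hs /map_autP Ht stx; apply/permP.
apply: (flag_ind (x := x)) => // y IH.
- by have [-> _ _] := Hs y; have [-> _ _] := Ht y; rewrite IH.
- by have [_ -> _] := Hs y; have [_ -> _] := Ht y; rewrite IH.
- by have [_ _ ->] := Hs y; have [_ _ ->] := Ht y; rewrite IH.
Qed.

(** If the automorphisms reach the three neighbours of one flag, they reach
    everything: from [y = s x] with [s] an automorphism one gets
    [chv y = s (chv x) = s (l x)], and likewise for the other two changes. *)
Lemma flag_triple_regular x l r t : flag_triple (M := M) x l r t -> regular_map M.
Proof.
case=> [[lA rA tA] [lx rx tx]]; split=> [|y]; last first.
  apply/trivgP/subsetP => s; rewrite inE => /andP [sA /astab1P sy].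
  rewrite inE; apply/eqP/(map_aut_eq (x := y)) => //.
  by rewrite perm1 -[RHS]sy.
apply/imsetP; exists x => //; apply/eqP; rewrite eq_sym eqEsubset subsetT /=.
apply/subsetP => y _; apply/orbitP; move: y.
apply: (flag_ind (x := x)) => [|_ [s sA <-]|_ [s sA <-]|_ [s sA <-]].
- by exists 1%g; rewrite ?group1 ?act1.
- exists (l * s)%g; rewrite ?groupM //= /aperm permM lx.
  by have [] := map_autP s sA x.
- exists (r * s)%g; rewrite ?groupM //= /aperm permM rx.
  by have [] := map_autP s sA x.
- exists (t * s)%g; rewrite ?groupM //= /aperm permM tx.
  by have [] := map_autP s sA x.
Qed.

Section Regular.
Hypothesis regM : regular_map M.

Lemma regular_trans x y : exists2 s : {perm flag M}, s \in map_aut M & s x = y.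
Proof.
case: regM => trM _; have := atransP trM x (in_setT x) => orbx.
have : y \in orbit 'P (map_aut M) x by rewrite orbx.
by case/orbitP=> s sA <-; exists s.
Qed.

Lemma regular_triple x : exists l r t, flag_triple (M := M) x l r t.
Proof.
have [l lA lx] := regular_trans x (chv x).
have [r rA rx] := regular_trans x (che x).
have [t tA tx] := regular_trans x (chf x).
by exists l, r, t.
Qed.

Lemma regular_card_aut : #|map_aut M| = #|flag M|.
Proof.
have /card_gt0P [x _] := flag_nonempty M.
case: regM => trM /(_ x) stab1.
have := card_orbit_stab 'P (map_aut M) x.
by rewrite stab1 cards1 muln1 (atransP trM x (in_setT x)) cardsT.
Qed.

Lemma regular_order (f : flag M -> flag M) x y :
    injective f ->
    (forall s : {perm flag M}, s \in map_aut M -> forall z, s (f z) = f (s z)) ->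
  fingraph.order f x = fingraph.order f y.
Proof.
move=> inj_f fA; have [s sA <-] := regular_trans y x.
by apply: order_conj (@perm_inj _ s) inj_f _ => z; apply: fA.
Qed.

Lemma regular_has_type p q r x :
    covalency x = p -> valency x = q -> petrie_length x = r ->
  has_type M p q r.
Proof.
move=> <- <- <- y.
have [vI eI fI] : [/\ injective (@chv M), injective (@che M) & injective (@chf M)].
  by split; apply: inv_inj; [apply: chvK | apply: cheK | apply: chfK].
split; apply: regular_order => [u v | s /map_autP Hs z].
- by move/vI/eI.
- by have [_ <- _] := Hs z; have [<- _ _] := Hs (che z).
- by move/fI/eI.
- by have [_ <- _] := Hs z; have [_ _ <-] := Hs (che z).
- by move/vI/fI/eI.
- have [_ <- _] := Hs z; have [_ _ <-] := Hs (che z).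
  by have [<- _ _] := Hs (chf (che z)).
Qed.

Lemma regular_card_orbits2 (a b : flag M -> flag M) x :
    involutive a -> involutive b ->
    (forall s : {perm flag M}, s \in map_aut M ->
       forall z, s (a z) = a (s z) /\ s (b z) = b (s z)) ->
  (#|[set orbit2 a b y | y : flag M]| * #|orbit2 a b x|)%N = #|flag M|.
Proof.
move=> aK bK abA; apply: card_orbits2 => // y.
have [s sA <-] := regular_trans x y.
by apply: orbit2_conj (@perm_inj _ s) _ _ => z; case: (abA s sA z).
Qed.

Lemma regular_counts x :
  [/\ (#|vertices M| * #|vertex_of x|)%N = #|flag M|,
      (#|edges M| * #|edge_of x|)%N = #|flag M|
    & (#|faces M| * #|face_of x|)%N = #|flag M|].
Proof.
split; apply: regular_card_orbits2 => [y|y|s /map_autP sA z];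
  by [rewrite ?chvK ?cheK ?chfK | case: (sA z)].
Qed.

Lemma is_map_of_aut (G : {set {perm flag M}}) x l r t :
  G = map_aut M -> flag_triple x l r t -> is_map_of M G l r t.
Proof.
move=> -> xlrt; split=> //; exists x, l, r, t, (idm (map_aut M)).
by split=> //; apply: idm_isom.
Qed.

End Regular.

(** The map [s |-> f (s x)] is a morphism: by connectedness
    [f (s y) = f y * f (s x)] for all [y], both sides being multiplied by the
    same factor on the left under a flag change.  Only the flag [x] has image 1,
    so it is injective, and then the orders force it to be onto. *)
Lemma map_aut_isog (gT : finGroupType) (G : {group gT}) (f : flag M -> gT)
    (a b c : gT) x :
    regular_map M -> #|G| <= #|flag M| -> (forall y, f y \in G) -> f x = 1%g ->
    (forall y, [/\ f (chv y) = (a * f y)%g, f (che y) = (b * f y)%g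
                 & f (chf y) = (c * f y)%g]) ->
    (forall y, f y = 1%g -> y = x) ->
  map_aut M \isog G.
Proof.
move=> regM leG fG fx1 fE f1.
have fact (s : {perm flag M}) y : s \in map_aut M -> f (s y) = (f y * f (s x))%g.
  move=> /map_autP sA; move: y; apply: (flag_ind (x := x)) => [|y IH|y IH|y IH].
  - by rewrite fx1 mul1g.
  - have [-> _ _] := sA y; have [-> _ _] := fE (s y); have [-> _ _] := fE y.
    by rewrite IH mulgA.
  - have [_ -> _] := sA y; have [_ -> _] := fE (s y); have [_ -> _] := fE y.
    by rewrite IH mulgA.
  - have [_ _ ->] := sA y; have [_ _ ->] := fE (s y); have [_ _ ->] := fE y.
    by rewrite IH mulgA.
pose phi (s : {perm flag M}) := f (s x).
have phiM : {in map_aut M &, {morph phi : s t / (s * t)%g >-> (s * t)%g}}.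
  by move=> s t _ tA; rewrite /phi permM fact.
have inj_phi : ('injm (Morphism phiM))%g.
  apply/subsetP => s /morphpreP [sA /set1gP /= phis].
  rewrite inE; apply/eqP/(map_aut_eq (x := x)) => //.
  by rewrite perm1; apply: f1.
apply/isogP; exists (Morphism phiM) => //; apply/eqP.
rewrite eqEcard; apply/andP; split.
  by apply/subsetP => g /morphimP [s _ _ ->]; apply: fG.
by rewrite card_injm // regular_card_aut.
Qed.

Lemma genus_counts v e f :
    #|vertices M| = v -> #|edges M| = e -> #|faces M| = f ->
  nonorientable_genus M = (2 - (v%:Z - e%:Z + f%:Z))%R.
Proof. by rewrite /nonorientable_genus /euler_char => -> -> ->. Qed.

(** Flag changes are numbered so that one word can be walked both in a map and in
    its Petrie dual. *)
Definition flag_step (k : nat) x :=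
  if k is k'.+1 then if k' is 0 then che x else chf x else chv x.

(** Along a walk a coherent orientation changes sign at each step, which is
    impossible on a closed walk of odd length. *)
Lemma nonorientable_odd_walk (w : seq nat) x :
  odd (size w) -> foldr flag_step x w = x -> nonorientable M.
Proof.
move=> odd_w wx [c cE].
have : c (foldr flag_step x w) = odd (size w) (+) c x.
  elim: w {odd_w wx} => //= k w IH; rewrite addNb -IH.
  by case: k => [|[|k]] /=; case: (cE (foldr flag_step x w)).
by rewrite wx odd_w; case: (c x).
Qed.

End Maps.

Lemma map_iso_covalency (M N : surfmap) x :
  map_iso M N -> exists y : flag N, covalency y = covalency (M := M) x.
Proof.
case=> f [/bij_inj inj_f fE]; exists (f x); apply: order_conj => // [u v|y].
  by move/(inv_inj (@chvK M))/(inv_inj (@cheK M)).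
by have [-> _ _] := fE (che y); have [_ -> _] := fE y.
Qed.

(** * Petrie duality *)

Section Petrie.
Variable M : surfmap.
Implicit Types x y : flag M.

Let chvf x := chv (chf x).

Lemma chvfK : involutive chvf.
Proof. by move=> x; rewrite /chvf -chvf_comm chfK chvK. Qed.

Lemma chvf_chf_comm x : chvf (chf x) = chf (chvf x).
Proof. by rewrite /chvf chvf_comm. Qed.

Lemma chvf_chf_free x : chvf (chf x) != x.
Proof. by rewrite /chvf chfK chv_free. Qed.

Lemma petrie_connected x y :
  connect [rel u v | [|| v == chvf u, v == che u | v == chf u]] x y.
Proof.
move: y; apply: (flag_ind (x := x)) => // y xy; apply: connect_trans xy _.
- have -> : chv y = chvf (chf y) by rewrite /chvf chfK.
  by apply: (connect_trans (y := chf y)); apply: connect1; rewrite /= eqxx ?orbT.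
- by apply: connect1; rewrite /= eqxx ?orbT.
- by apply: connect1; rewrite /= eqxx ?orbT.
Qed.

Definition petrie : surfmap :=
  Surfmap chvfK (@cheK M) (@chfK M) (@chvf_free M) (@che_free M) (@chf_free M)
    chvf_chf_comm chvf_chf_free (@flag_nonempty M) petrie_connected.

Lemma map_aut_petrie : map_aut petrie = map_aut M.
Proof.
apply/setP => s; apply/(map_autP (M := petrie))/(map_autP (M := M)) => sA x;
  have [_ He Hf] := sA x.
  split=> //; have [+ _ _] := sA (chf x).
  by rewrite /= /chvf chfK Hf chfK.
by split=> //; rewrite /= /chvf; have [-> _ _] := sA (chf x); rewrite Hf.
Qed.

Lemma flag_triple_petrie x l r t :
  flag_triple (M := M) x l r t -> flag_triple (M := petrie) x (l * t)%g r t.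
Proof.
case=> [[lA rA tA] [lx rx tx]]; split.
  by rewrite map_aut_petrie; split=> //; apply: (groupM (G := map_aut_group M)).
split=> //; rewrite permM lx /= /chvf; have [-> _ _] := map_autP t tA x.
by rewrite tx.
Qed.

Lemma regular_petrie : regular_map M -> regular_map petrie.
Proof.
move=> regM; have /card_gt0P [x _] := flag_nonempty M.
have [l [r [t /flag_triple_petrie]]] := regular_triple regM x.
exact: flag_triple_regular.
Qed.

(** The two directions are symmetric because [t] is an involution:
    [(l * t) * t = l]. *)
Lemma petrie_is_dual : regular_map M ->
  is_petrie_dual M petrie /\ is_petrie_dual petrie M.
Proof.
move=> regM; have /card_gt0P [x _] := flag_nonempty M.
have [l [r [t xlrt]]] := regular_triple regM x.
have xlrt' := flag_triple_petrie xlrt; split.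
  split=> //; exists x, l, r, t; split=> //.
  by apply: is_map_of_aut xlrt' => //; [exact: regular_petrie | rewrite map_aut_petrie].
split; first exact: regular_petrie.
exists x, (l * t)%g, r, t; split=> //.
have tt1 : (t * t = 1)%g.
  case: xlrt => [[_ _ tA] [_ _ tx]].
  apply: (map_aut_eq (x := x)); rewrite ?groupM ?group1 //.
  by rewrite permM perm1 tx; have [_ _ ->] := map_autP t tA x; rewrite tx chfK.
by rewrite -mulgA tt1 mulg1; apply: is_map_of_aut xlrt => //; rewrite map_aut_petrie.
Qed.

(** [chv] is recovered as [chvf \o chf], so both pairs of changes generate the
    same four flags. *)
Lemma edge_of_petrie x : edge_of (M := petrie) x = edge_of (M := M) x.
Proof.
apply/setP => y; apply/idP/idP.
  apply: (orbit2_ind (P := fun z => z \in edge_of (M := M) x)) => [|z|z].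
  - exact: orbit2_refl.
  - by case/orbit2_step/andP=> _ /orbit2_step /andP [].
  - by case/orbit2_step/andP.
apply: (orbit2_ind (P := fun z => z \in edge_of (M := petrie) x)) => [|z|z].
- exact: orbit2_refl.
- case/orbit2_step/andP=> _ /orbit2_step /andP [].
  by rewrite /= /chvf chfK.
- by case/orbit2_step/andP.
Qed.

Lemma vertices_petrie : vertices petrie = vertices M.
Proof. by []. Qed.

Lemma edges_petrie : edges petrie = edges M.
Proof. exact: eq_imset edge_of_petrie. Qed.

(** Changing the face does not change the vertex, so [chvf x] and [chv x] have
    the same label. *)
Lemma embeds_petrie (V : finType) (adj : rel V) :
  embeds M adj -> embeds petrie adj.
Proof.
case=> lab [lab_onto lab_vertex lab_adj lab_dart lab_edge].
have labf x : lab (chf x) = lab x.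
  by apply/lab_vertex; case: (orbit2_stepE (@cheK M) (@chfK M) x).
have labvf x : lab (chvf x) = lab (chv x) by rewrite /chvf chvf_comm labf.
exists lab; split=> //= [x|u v /lab_dart [x [xu xv]]|x y].
- by rewrite labvf.
- by exists x; rewrite labvf.
- by rewrite !labvf => /lab_edge; rewrite !edge_of_petrie.
Qed.

(** Faces and Petrie polygons are exchanged. *)
Lemma has_type_petrie p q r : has_type M p q r -> has_type petrie r q p.
Proof.
move=> Mpqr x; have [cov val pet] := Mpqr x; split=> //.
rewrite -cov; apply: eq_card; apply: eq_fconnect => y.
by rewrite /= /chvf chfK.
Qed.

End Petrie.

(** * The field with 9 elements and PGL(2, 9) *)

(** The pair [(a, b)] of residues modulo 3 stands for [a + b * i] with
    [i ^ 2 = -1]; natural numbers make the arithmetic evaluate by computation. *)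
Definition F9 := (nat * nat)%type.
Definition add9 (x y : F9) : F9 := ((x.1 + y.1) %% 3, (x.2 + y.2) %% 3).
Definition mul9 (x y : F9) : F9 :=
  ((x.1 * y.1 + 2 * (x.2 * y.2)) %% 3, (x.1 * y.2 + x.2 * y.1) %% 3).

(** Conjugate times norm: the norm is 1 or 2 for nonzero [x], so it is its own
    inverse modulo 3. *)
Definition inv9 (x : F9) : F9 :=
  let n := x.1 ^ 2 + x.2 ^ 2 in ((n * x.1) %% 3, (2 * n * x.2) %% 3).
Definition mx9 := ((F9 * F9) * (F9 * F9))%type.
Definition mulmx9 (m p : mx9) : mx9 :=
  let: ((a, b), (c, d)) := m in let: ((e, f), (g, h)) := p in
  ((add9 (mul9 a e) (mul9 b g), add9 (mul9 a f) (mul9 b h)),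
   (add9 (mul9 c e) (mul9 d g), add9 (mul9 c f) (mul9 d h))).

(** The first nonzero entry, the top row of an invertible matrix being nonzero;
    dividing by it picks one representative of each class modulo scalars. *)
Definition pivot9 (m : mx9) : F9 := if m.1.1 == (0, 0) then m.1.2 else m.1.1.
Definition scale9 (k : F9) (m : mx9) : mx9 :=
  let: ((a, b), (c, d)) := m in ((mul9 k a, mul9 k b), (mul9 k c, mul9 k d)).
Definition pmul9 (m p : mx9) : mx9 :=
  let q := mulmx9 m p in scale9 (inv9 (pivot9 q)) q.
Definition det9 (m : mx9) : F9 :=
  let: ((a, b), (c, d)) := m in add9 (mul9 a d) (mul9 (2, 0) (mul9 b c)).

(** Invertibility stated by a witness, so that it is inherited by every field in
    which the pairs are read. *)
Definition unit9 (x : F9) := mul9 x (inv9 x) == (1, 0).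

Section FieldOfOrder9.
Import GRing.Theory.
Local Open Scope ring_scope.

Variable F : finFieldType.
Hypothesis cardF : #|F| = 9%N.

Lemma char3 : 3%:R = 0 :> F.
Proof.
have /eqP : 9%:R = 0 :> F.
  by rewrite -cardF -cardsT -FinRing.zmodXgE expg_cardG ?inE.
by rewrite (natrM _ 3 3) mulf_eq0 orbb => /eqP.
Qed.

(** A nonzero [x] satisfies [x ^+ 8 = 1], that is,
    [(x ^+ 2 - 1) * (x ^+ 2 + 1) * (x ^+ 4 + 1) = 0].  If [x] is neither 1 nor -1
    the first factor is nonzero, and then [x] or [x ^+ 2] squares to -1. *)
Lemma exists_sqrtN1 : exists i : F, i ^+ 2 = -1.
Proof.
(* nine elements, so some x differs from 0, 1 and -1 *)
have /subsetPn [x _] : ~~ (F \subset [:: 0; 1; -1]).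
  apply/negP => /subset_leq_card; rewrite cardF => le9.
  by have := leq_trans le9 (card_size _).
rewrite !inE => /norP [x0 /norP [x1 xN1]].
have /eqP : (x ^+ 2 - 1) * (x ^+ 2 + 1) * (x ^+ 4 + 1) = 0.
  apply: (mulfI x0); rewrite mulr0.
  rewrite [LHS](_ : _ = x ^+ 9 - x); last by ring.
  by rewrite -[in x ^+ 9]cardF expf_card subrr.
rewrite !mulf_eq0 subr_sqr_1 mulf_eq0 subr_eq0 !addr_eq0 (negPf x1) (negPf xN1) /=.
case/orP => /eqP; first by exists x.
by exists (x ^+ 2); rewrite -exprM.
Qed.

Variable i : F.
Hypothesis i2 : i ^+ 2 = -1.

Definition embed9 (x : F9) : F := x.1%:R + x.2%:R * i.

Lemma natr_mod3 n : (n %% 3)%:R = n%:R :> F.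
Proof. by rewrite [in RHS](divn_eq n 3) natrD natrM char3 mulr0 add0r. Qed.

Lemma embed9D x y : embed9 (add9 x y) = embed9 x + embed9 y.
Proof. by rewrite /embed9 /= !natr_mod3 !natrD; ring. Qed.

Lemma embed9M x y : embed9 (mul9 x y) = embed9 x * embed9 y.
Proof.
rewrite /embed9 /= !natr_mod3 !(natrD, natrM).
have two : 2%:R = -1 :> F by apply/eqP; rewrite -addr_eq0 -mulrSr char3.
by rewrite two -i2; ring.
Qed.

Lemma embed9_unit x : unit9 x -> embed9 x != 0.
Proof.
move=> /eqP xV; apply/eqP => x0; have := embed9M x (inv9 x).
rewrite xV x0 mul0r /embed9 /= mul0r addr0 => /eqP.
by rewrite oner_eq0.
Qed.

Lemma embed9_0 : embed9 (0, 0)%N = 0. Proof. by rewrite /embed9 mul0r addr0. Qed.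

Lemma embed9_1 : embed9 (1, 0)%N = 1. Proof. by rewrite /embed9 mul0r addr0. Qed.

Lemma embed9_2 : embed9 (2, 0)%N = -1.
Proof. by apply/eqP; rewrite /embed9 mul0r addr0 -addr_eq0 -mulrSr char3. Qed.

Definition embed_mx (m : mx9) : 'M[F]_2 :=
  \matrix_(r < 2, c < 2)
    embed9 (let row := if r == 0 then m.1 else m.2 in
            if c == 0 then row.1 else row.2).

Lemma embed_mx1 : embed_mx (((1, 0), (0, 0)), ((0, 0), (1, 0)))%N = 1%:M.
Proof.
apply/matrixP => r s; rewrite !mxE /= -(val_eqE r s).
by case: r s => [[|[|r]] rP] [[|[|s]] sP] //; rewrite /= ?embed9_1 ?embed9_0.
Qed.

Lemma embed_mxM m p : embed_mx (mulmx9 m p) = embed_mx m *m embed_mx p.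
Proof.
case: m p => [[a b] [c d]] [[e f] [g h]]; apply/matrixP => r s.
rewrite !mxE !big_ord_recl big_ord0 !mxE /= addr0.
by case: (r == 0); case: (s == 0); rewrite embed9D !embed9M.
Qed.

Lemma embed_mxZ k m : embed_mx (scale9 k m) = embed9 k *: embed_mx m.
Proof.
case: m => [[a b] [c d]]; apply/matrixP => r s.
by rewrite !mxE; case: (r == 0); case: (s == 0); rewrite /= embed9M.
Qed.

Lemma embed_mx_unit m : unit9 (det9 m) -> embed_mx m \in unitmx.
Proof.
move=> /embed9_unit; rewrite unitmxE unitfE; case: m => [[a b] [c d]] /=.
rewrite (expand_det_row _ ord0) !big_ord_recl big_ord0 /cofactor !det_mx11 !mxE /=.
rewrite embed9D !embed9M expr0 expr1 !mul1r addr0.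
by rewrite embed9_2 mulN1r mulN1r mulrN.
Qed.

(** The default value 1 is taken at singular matrices. *)
Definition GLof (A : 'M[F]_2) : {'GL_2[F]} :=
  if insub (A : 'M[F]_2.-1.+1) is Some u then u else 1%g.

Lemma GLofE A : A \in unitmx -> GLval (GLof A) = A.
Proof.
by move=> UA; rewrite /GLof; case: insubP => [u _ -> // |]; rewrite UA.
Qed.

Local Notation Z := 'Z('GL_2[F])%g.

Lemma scalar_central (u : {'GL_2[F]}) k : GLval u = k%:M -> u \in Z.
Proof.
move=> uk; apply/centerP; split=> [|w _]; first by rewrite inE.
by apply: (val_inj : injective (@GLval 2 F)); rewrite !GL_MxE uk scalar_mxC.
Qed.

Lemma normal_center : (Z <| 'GL_2[F])%g. Proof. exact: center_normal. Qed.

Lemma in_norm_center (u : {'GL_2[F]}) : u \in 'N(Z)%g.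
Proof. by apply: (subsetP (normal_norm normal_center)); rewrite inE. Qed.

Lemma coset_scale (u v : {'GL_2[F]}) k :
  GLval u = k *: GLval v -> coset Z u = coset Z v.
Proof.
move=> uv; apply/eqP; rewrite eq_mulgV1 -morphV ?in_norm_center //.
rewrite -morphM ?groupV ?in_norm_center //; apply/eqP/coset_id.
apply: (scalar_central (k := k)).
by rewrite GL_MxE uv -scalemxAl GL_VxE mulmxV ?GL_unitmx // scalemx1.
Qed.

(** Commuting with the two elementary unipotent matrices already forces a matrix
    to be scalar. *)
Lemma central_entries (u : {'GL_2[F]}) : u \in Z ->
  [/\ GLval u 0 1 = 0, GLval u 1 0 = 0 & GLval u 0 0 = GLval u 1 1].
Proof.
case/centerP=> _ cu.
have comm m r s : unit9 (det9 m) ->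
    (GLval u *m embed_mx m) r s = (embed_mx m *m GLval u) r s.
  move=> Um; rewrite -(GLofE (embed_mx_unit Um)) -!GL_MxE.
  by rewrite (cu (GLof _)) ?inE.
have := comm (((1, 0), (1, 0)), ((0, 0), (1, 0)))%N 0 0 isT.
have := comm (((1, 0), (1, 0)), ((0, 0), (1, 0)))%N 0 1 isT.
have := comm (((1, 0), (0, 0)), ((1, 0), (1, 0)))%N 0 0 isT.
rewrite !mxE !big_ord_recl !big_ord0 !mxE /= !embed9_1 !embed9_0.
rewrite [lift _ _](_ : _ = 1); last exact: val_inj.
rewrite [ord0](_ : _ = 0); last exact: val_inj.
rewrite !(mulr1, mul1r, mulr0, mul0r, addr0, add0r).
move=> /(canRL (addKr _)); rewrite addNr => u01.
rewrite u01 addr0 add0r => u00 /esym/(canRL (addKr _)).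
by rewrite addNr.
Qed.

(** The eight nonzero scalar matrices are central. *)
Lemma card_center : (8 <= #|Z|)%N.
Proof.
have <- : #|[set GLof k%:M | k in [set~ 0 : F]]| = 8%N.
  rewrite card_in_imset ?cardsC1 ?cardF // => k l; rewrite !inE => k0 l0 eqkl.
  have unit_scalar (h : F) : h != 0 -> h%:M \in @unitmx F 2.
    by move=> h0; rewrite unitmxE det_scalar unitfE expf_neq0.
  have := congr1 (fun u => GLval u 0 0) eqkl.
  by rewrite !GLofE ?unit_scalar // !mxE.
apply/subset_leq_card/subsetP => _ /imsetP [k k0 ->]; move: k0.
rewrite in_setC1 => k0.
apply: (scalar_central (k := k)).
by rewrite GLofE // unitmxE det_scalar unitfE expf_neq0.
Qed.

Lemma card_PGL : (#|PGL 2 F| <= 720)%N.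
Proof.
rewrite card_quotient ?normal_norm ?normal_center //.
rewrite -(leq_pmul2l (isT : 0 < 8)%N).
apply: leq_trans (leq_mul card_center (leqnn _)) _.
by rewrite Lagrange ?normal_sub ?normal_center // card_GL_2 cardF.
Qed.

End FieldOfOrder9.

(** * The 720 elements of PGL(2, 9), with their action on 12 lines *)

Section Reach.
Variables (C : eqType) (fs : seq (C -> C)).

(** Breadth-first search: [front] is the layer found last, [seen] everything
    found so far, and [n] bounds the number of layers. *)
Fixpoint reach (n : nat) (front seen : seq C) : seq C :=
  if n is n'.+1 then
    let new := undup [seq x <- [seq f x | f <- fs, x <- front] | x \notin seen] in
    reach n' new (new ++ seen)
  else seen.

(** Whatever holds at the start and is preserved by the steps holds at all points
    found; this is how connectedness follows from the search. *)
Lemma reach_ind (P : C -> Prop) n front seen :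
    (forall x, x \in front -> P x) -> (forall x, x \in seen -> P x) ->
    (forall x, P x -> foldr (fun f Q => P (f x) /\ Q) True fs) ->
  forall x, x \in reach n front seen -> P x.
Proof.
move=> + + Pfs; elim: n front seen => [|n IH] front seen Pfront Pseen //=.
have Pnew x :
    x \in undup [seq x <- [seq f x | f <- fs, x <- front] | x \notin seen] -> P x.
  rewrite mem_undup mem_filter => /andP [_].
  elim: fs Pfs => //= f fs' IHfs Pfs.
  rewrite mem_cat => /orP [/mapP [y /Pfront/Pfs [Pfy _] ->] //|].
  by apply: IHfs => y /Pfs [].
by apply: IH => // x; rewrite mem_cat => /orP [/Pnew | /Pseen].
Qed.

End Reach.

Definition gcode := (seq nat * mx9)%type.

(** Products act from left to right, on points as on row vectors: [g] first, then
    [h]. *)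
Definition gmul (g h : gcode) : gcode :=
  ([seq nth 0 h.1 k | k <- g.1], pmul9 g.2 h.2).

(** In the permutations, 0 to 5 are the rows of the 6 x 6 grid and 6 to 11 its
    columns, numbered so that R exchanges row [k] with column [k]. *)
Definition g1 : gcode := (iota 0 12, (((1, 0), (0, 0)), ((0, 0), (1, 0)))).
Definition gL : gcode :=
  ([:: 0; 1; 3; 2; 5; 4; 9; 7; 10; 6; 8; 11],
   (((0, 0), (1, 0)), ((1, 0), (0, 0)))).
Definition gR : gcode :=
  ([:: 6; 7; 8; 9; 10; 11; 0; 1; 2; 3; 4; 5],
   (((1, 0), (0, 1)), ((1, 0), (2, 0)))).
Definition gT : gcode :=
  ([:: 0; 1; 5; 4; 3; 2; 6; 11; 10; 9; 8; 7],
   (((0, 0), (1, 0)), ((2, 0), (0, 0)))).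
Definition gens := [:: gL; gR; gT].

(** The image of the cell in row 0 and column 0; when rows and columns are
    exchanged, the row is the image of point 6. *)
Definition cell (m : gcode) : nat * nat :=
  let: (a, b) := (nth 0 m.1 0, nth 0 m.1 6) in
  if a < 6 then (a, b - 6) else (b, a - 6).

Definition cells : seq (nat * nat) := [seq (a, b) | a <- iota 0 6, b <- iota 0 6].
Definition adj_cell (u v : nat * nat) : bool := (u.1 != v.1) + (u.2 != v.2) == 1.
Definition dart (m : gcode) := (cell m, cell (gmul gL m)).

Definition check_gens (s : seq gcode) :=
  all (fun g => all (fun m =>
    [&& gmul g m \in s, gmul g m != m & gmul g (gmul g m) == m]) s) gens.
Definition check_LT (s : seq gcode) :=
  all (fun m => (gmul gL (gmul gT m) != m)
             && (gmul gL (gmul gT m) == gmul gT (gmul gL m))) s.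
Definition check_assoc (s : seq gcode) :=
  all (fun g => all (fun h => all (fun m =>
    gmul (gmul g m) h == gmul g (gmul m h)) s) gens) gens.
Definition check_cells (s : seq gcode) :=
  all (fun m => [&& cell m \in cells, cell (gmul gR m) == cell m,
                    cell (gmul gT m) == cell m
                  & adj_cell (cell m) (cell (gmul gL m))]) s.

(** Each arc of the graph comes from some flag, and the flags with the same arc
    as [m] are [m] and [gmul gT m]: [y] is the first flag in the list with that
    arc. *)
Definition check_darts (s : seq gcode) (darts : seq ((nat * nat) * (nat * nat))) :=
  all (fun u => all (fun v => adj_cell u v ==> ((u, v) \in darts)) cells) cells &&
  all (fun m => let y := nth g1 s (index (dart m) darts) in
                (m == y) || (m == gmul gT y)) s.

(** All matrices are invertible, and only the identity is scalar: for any other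
    one an off-diagonal entry or the difference [a - d] is invertible. *)
Definition check_mx (s : seq gcode) :=
  all (fun m => let: ((a, b), (c, d)) := m.2 in
    unit9 (det9 m.2) &&
    [|| unit9 b, unit9 c, unit9 (add9 a (mul9 (2, 0) d)) | m == g1]) s.

Definition checks (s : seq gcode) :=
  [&& [&& uniq s, size s == 720 & g1 \in s],
      [&& check_gens s, check_LT s & check_assoc s]
    & [&& check_cells s, check_darts s (map dart s) & check_mx s]].

(* Locking keeps simplification and unification from running the search. *)
Fact elts_key : unit. Proof. exact: tt. Qed.
Definition elts : seq gcode :=
  locked_with elts_key (reach [:: gmul gL; gmul gR; gmul gT] 15 [:: g1] [:: g1]).

Lemma eltsE : elts = reach [:: gmul gL; gmul gR; gmul gT] 15 [:: g1] [:: g1].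
Proof. exact: locked_withE. Qed.

(** The finite verification, evaluated in one run so that the search is made only
    once; the lemmas on [elts] below are its components. *)
Lemma elts_checks : checks elts.
Proof. by rewrite eltsE; vm_cast_no_check (erefl true). Qed.

(** * The Cayley map of PGL(2, 9) *)

Lemma elts_uniq : uniq elts.
Proof. by have /and3P [/and3P []] := elts_checks. Qed.

Lemma elts_size : size elts = 720.
Proof. by have /and3P [/and3P [_ /eqP]] := elts_checks. Qed.

Lemma g1_in : g1 \in elts.
Proof. by have /and3P [/and3P []] := elts_checks. Qed.

Lemma elts_gens g m : g \in gens -> m \in elts ->
  [/\ gmul g m \in elts, gmul g m != m & gmul g (gmul g m) = m].
Proof.
have /and3P [_ /and3P [/allP gensP _ _] _] := elts_checks.
by move=> /gensP/allP gP /gP /and3P [? ? /eqP].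
Qed.

Lemma elts_LT m : m \in elts ->
  gmul gL (gmul gT m) != m /\ gmul gL (gmul gT m) = gmul gT (gmul gL m).
Proof.
have /and3P [_ /and3P [_ /allP LTP _] _] := elts_checks.
by move=> /LTP /andP [? /eqP].
Qed.

Lemma elts_assoc g h m : g \in gens -> h \in gens -> m \in elts ->
  gmul (gmul g m) h = gmul g (gmul m h).
Proof.
have /and3P [_ /and3P [_ _ /allP assocP] _] := elts_checks.
by move=> /assocP/allP gP /gP/allP hP /hP /eqP.
Qed.

Lemma gens_base :
  all (fun g => [&& gmul g1 g == g, gmul g g1 == g & gmul g g == g1]) gens.
Proof. by vm_compute. Qed.

Definition pflag := seq_sub elts.
Definition base : pflag := SeqSub g1_in.

(** The default value is not taken for generators: [val_lmul] and [val_rmul] show that products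
    with generators stay in the list. *)
Definition lmul (g : gcode) (x : pflag) : pflag := insubd x (gmul g (val x)).
Definition rmul (g : gcode) (x : pflag) : pflag := insubd x (gmul (val x) g).

Lemma card_pflag : #|{: pflag}| = 720.
Proof. by rewrite card_seq_sub ?elts_uniq ?elts_size. Qed.

Lemma mem_pflag (x : pflag) : val x \in elts. Proof. exact: valP. Qed.

Lemma val_lmul g : g \in gens -> forall x, val (lmul g x) = gmul g (val x).
Proof.
move=> gP x; rewrite val_insubd.
by have [-> _ _] := elts_gens gP (mem_pflag x).
Qed.

Lemma gL_in : gL \in gens. Proof. by []. Qed.
Lemma gR_in : gR \in gens. Proof. by []. Qed.
Lemma gT_in : gT \in gens. Proof. by []. Qed.

Lemma lmulK g : g \in gens -> involutive (lmul g).
Proof.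
move=> gP x; apply: val_inj; rewrite !val_lmul //.
by have [] := elts_gens gP (mem_pflag x).
Qed.

Lemma lmul_free g : g \in gens -> forall x, lmul g x != x.
Proof.
move=> gP x; rewrite -val_eqE val_lmul //.
by have [] := elts_gens gP (mem_pflag x).
Qed.

Lemma lmul_comm x : lmul gL (lmul gT x) = lmul gT (lmul gL x).
Proof.
apply: val_inj; rewrite !val_lmul //.
by have [] := elts_LT (mem_pflag x).
Qed.

Lemma lmulLT_free x : lmul gL (lmul gT x) != x.
Proof.
rewrite -val_eqE !val_lmul //.
by have [] := elts_LT (mem_pflag x).
Qed.

(** The list was found by search from 1, so every flag is a product of
    generators. *)
Lemma pflag_ind (P : pflag -> Prop) :
  P base -> (forall g x, g \in gens -> P x -> P (lmul g x)) -> forall x, P x.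
Proof.
move=> Pbase Pstep x.
suff [y xy Py] : exists2 y, val x = val y & P y by rewrite (val_inj xy).
move: (val x) (mem_pflag x) => m; rewrite {1}eltsE; move: m.
apply: reach_ind => [m|m|m [y -> Py]]; rewrite ?inE.
- by move=> /eqP ->; exists base.
- by move=> /eqP ->; exists base.
do !split=> //.
- by exists (lmul gL y); rewrite ?val_lmul //; apply: Pstep.
- by exists (lmul gR y); rewrite ?val_lmul //; apply: Pstep.
- by exists (lmul gT y); rewrite ?val_lmul //; apply: Pstep.
Qed.

Lemma pflag_connected x y :
  connect [rel u v | [|| v == lmul gL u, v == lmul gR u | v == lmul gT u]] x y.
Proof.
set e := rel_of_simpl _.
have e_sym : connect_sym e.
  apply: sym_connect_sym => u v; rewrite /e /=.
  by rewrite ![v == _]eq_sym !(inv_eq (lmulK _)).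
have from_base z : connect e base z.
  move: z; apply: pflag_ind => [|g z gP]; first exact: connect0.
  move=> bz; apply: connect_trans bz (connect1 _); move: gP.
  by rewrite !inE => /or3P [] /eqP ->; rewrite /e /= eqxx ?orbT.
by apply: connect_trans (from_base y); rewrite e_sym.
Qed.

Lemma pflag_nonempty : (0 < #|{: pflag}|)%N.
Proof. by rewrite card_pflag. Qed.

(** The map of type {10,10}_8; its Petrie dual is [map8]. *)
Definition map10 : surfmap :=
  Surfmap (lmulK gL_in) (lmulK gR_in) (lmulK gT_in)
    (lmul_free gL_in) (lmul_free gR_in) (lmul_free gT_in)
    lmul_comm lmulLT_free pflag_nonempty pflag_connected.

(** Closure under right multiplication follows from closure under left
    multiplication by associativity, by induction on the flag. *)
Lemma val_rmul h x : h \in gens -> val (rmul h x) = gmul (val x) h.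
Proof.
move=> hP; rewrite val_insubd ifT //; move: x.
have [/eqP g1h /eqP hg1 _] := and3P (allP gens_base h hP).
apply: pflag_ind => [|g x gP IH].
  by rewrite /= g1h -hg1; case: (elts_gens hP g1_in).
rewrite val_lmul // elts_assoc ?mem_pflag //.
by case: (elts_gens gP IH).
Qed.

Lemma lmul_rmul g h x : g \in gens -> h \in gens ->
  rmul h (lmul g x) = lmul g (rmul h x).
Proof.
move=> gP hP; apply: val_inj.
by rewrite val_rmul ?val_lmul ?val_rmul ?elts_assoc ?mem_pflag.
Qed.

Lemma rmulK h : h \in gens -> involutive (rmul h).
Proof.
move=> hP; apply: pflag_ind => [|g x gP IH]; last by rewrite !lmul_rmul ?IH.
have [/eqP g1h _ /eqP hh] := and3P (allP gens_base h hP).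
by apply: val_inj; rewrite !val_rmul //= g1h.
Qed.

Lemma rmul_base h : h \in gens -> rmul h base = lmul h base.
Proof.
move=> hP; apply: val_inj; rewrite val_rmul ?val_lmul //=.
by have [/eqP -> /eqP -> _] := and3P (allP gens_base h hP).
Qed.

Lemma rmul_aut h (hP : h \in gens) :
  perm (inv_inj (rmulK hP)) \in map_aut map10.
Proof.
by apply/(map_autP (M := map10)) => x; split; rewrite !permE lmul_rmul.
Qed.

Lemma regular_map10 : regular_map map10.
Proof.
apply: (flag_triple_regular (M := map10) (x := base)
  (l := perm (inv_inj (rmulK gL_in))) (r := perm (inv_inj (rmulK gR_in)))
  (t := perm (inv_inj (rmulK gT_in)))).
by split; [split; apply: rmul_aut | split; rewrite permE rmul_base].
Qed.

(** Cycle lengths at the flag 1 can be computed on the underlying data. *)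
Lemma order_base (f : pflag -> pflag) (fc : gcode -> gcode) n :
    (forall x, val (f x) = fc (val x)) ->
    [&& 0 < n, iter n fc g1 == g1 & uniq (traject fc g1 n)] ->
  fingraph.order f base = n.
Proof.
move=> vf /and3P [n_gt0 /eqP iter_n uniq_n].
have viter k : val (iter k f base) = iter k fc g1 by elim: k => //= k <-; rewrite vf.
apply: order_eq_traject => //; first by apply: val_inj; rewrite viter.
rewrite -(map_inj_uniq val_inj).
suff vtraject x k : map val (traject f x k) = traject fc (val x) k.
  by rewrite vtraject.
by elim: k x => //= k IH x; rewrite IH vf.
Qed.

(** Sizes of vertices, edges and faces at the flag 1 can be found by searching
    from 1 with two steps only, once the result is seen to be closed. *)
Lemma card_orbit2_base (a b : pflag -> pflag) (ac bc : gcode -> gcode) n k :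
    (forall x, val (a x) = ac (val x)) -> (forall x, val (b x) = bc (val x)) ->
    (let s := reach [:: ac; bc] n [:: g1] [:: g1] in
     [&& uniq s, size s == k, g1 \in s
       & all (fun m => (ac m \in s) && (bc m \in s)) s]) ->
  #|orbit2 a b base| = k.
Proof.
move=> va vb; set s := reach _ _ _ _ => /= /and4P [Us /eqP <- s1 /allP closed_s].
rewrite cardE -(size_map val); apply/perm_size/uniq_perm => // [|m].
  by rewrite (map_inj_uniq val_inj) enum_uniq.
apply/mapP/idP => [[y + ->]|].
  rewrite mem_enum; apply: (orbit2_ind (P := fun y => val y \in s)) => // z.
    by move/closed_s; rewrite va => /andP [].
  by move/closed_s; rewrite vb => /andP [].
apply: (reach_ind (P := fun m => exists2 y, y \in enum (orbit2 a b base) & m = val y)).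
- by move=> z; rewrite inE => /eqP ->; exists base; rewrite ?mem_enum ?orbit2_refl.
- by move=> z; rewrite inE => /eqP ->; exists base; rewrite ?mem_enum ?orbit2_refl.
move=> _ [y yb ->]; move: yb; rewrite mem_enum => /orbit2_step/andP [ya yb].
do !split=> //.
- by exists (a y); rewrite ?mem_enum.
- by exists (b y); rewrite ?mem_enum.
Qed.

(** * Types, numbers of faces, and nonorientability *)

Definition map8 := petrie map10.

Lemma regular_map8 : regular_map map8.
Proof. exact: regular_petrie regular_map10. Qed.

Lemma pflag_quotient n c k :
  n * c = #|{: pflag}| -> c = k -> 0 < k -> n = 720 %/ k.
Proof. by rewrite card_pflag => <- -> k_gt0; rewrite mulnK. Qed.

Lemma counts_map10 : [/\ #|vertices map10| = 36, #|edges map10| = 180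
  & #|faces map10| = 36].
Proof.
have vertex20 : #|vertex_of (M := map10) base| = 20.
  apply: (card_orbit2_base (n := 10) (val_lmul gR_in) (val_lmul gT_in)).
  by vm_compute.
have edge4 : #|edge_of (M := map10) base| = 4.
  apply: (card_orbit2_base (n := 2) (val_lmul gL_in) (val_lmul gT_in)).
  by vm_compute.
have face20 : #|face_of (M := map10) base| = 20.
  apply: (card_orbit2_base (n := 10) (val_lmul gL_in) (val_lmul gR_in)).
  by vm_compute.
have [v e f] := regular_counts regular_map10 base.
split.
- exact: (pflag_quotient v vertex20 isT).
- exact: (pflag_quotient e edge4 isT).
- exact: (pflag_quotient f face20 isT).
Qed.

Lemma counts_map8 : [/\ #|vertices map8| = 36, #|edges map8| = 180
  & #|faces map8| = 45].
Proof.
have [v e _] := counts_map10.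
have valLT x : val (lmul gL (lmul gT x)) = gmul gL (gmul gT (val x)).
  by rewrite !val_lmul.
have face16 : #|face_of (M := map8) base| = 16.
  apply: (card_orbit2_base (ac := fun m => gmul gL (gmul gT m)) (bc := gmul gR) (n := 8)
            valLT (val_lmul gR_in)).
  by vm_compute.
have [_ _ f] := regular_counts regular_map8 base.
split.
- by rewrite (vertices_petrie map10).
- by rewrite (edges_petrie map10).
- exact: (pflag_quotient f face16 isT).
Qed.

Lemma has_type_map10 : has_type map10 10 10 8.
Proof.
apply: (regular_has_type regular_map10 (x := base)).
- apply: (order_base (f := fun y => lmul gL (lmul gR y))
            (fc := fun m => gmul gL (gmul gR m))) => [x|]; last by vm_compute.
  by rewrite !val_lmul.
- apply: (order_base (f := fun y => lmul gT (lmul gR y))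
            (fc := fun m => gmul gT (gmul gR m))) => [x|]; last by vm_compute.
  by rewrite !val_lmul.
- apply: (order_base (f := fun y => lmul gL (lmul gT (lmul gR y)))
            (fc := fun m => gmul gL (gmul gT (gmul gR m)))) => [x|]; last by vm_compute.
  by rewrite !val_lmul.
Qed.

(** A product of 15 factors L, R, T (written 0, 1, 2) that is trivial, and remains
    trivial when L T is put for L; hence it serves for both maps. *)
Definition odd_word : seq nat := [:: 2; 1; 0; 1; 2; 0; 1; 0; 1; 2; 0; 1; 0; 1; 0].

Lemma nonorientable_map10 : nonorientable map10.
Proof.
apply: (nonorientable_odd_walk (w := odd_word) (x := base : flag map10)) => //.
by apply: val_inj; rewrite /= !val_lmul.
Qed.

Lemma nonorientable_map8 : nonorientable map8.
Proof.
apply: (nonorientable_odd_walk (w := odd_word) (x := base : flag map8)) => //.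
by apply: val_inj; rewrite /= !val_lmul.
Qed.

(** Faces with 10 sides on one map, with 8 on the other. *)
Lemma map10_not_iso_map8 : ~ map_iso map10 map8.
Proof.
case/(map_iso_covalency (M := map10) base) => y.
have [-> _ _] := has_type_map10 base.
by have [-> _ _] := has_type_petrie has_type_map10 y.
Qed.

(** * The embedded graph *)

Definition vertex_at (u : nat * nat) : {ffun 'I_2 -> 'I_6} :=
  [ffun k : 'I_2 => inord (if k == 0%R :> 'I_2 then u.1 else u.2)].

Lemma mem_cellsP u : reflect (u.1 < 6 /\ u.2 < 6) (u \in cells).
Proof.
case: u => a b; apply: (iffP allpairsP) => [[[c d] []]|[a6 b6]].
  by rewrite !mem_iota => /andP [_ c6] /andP [_ d6] [-> ->].
by exists (a, b); split=> //; rewrite mem_iota.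
Qed.

Lemma ord2_cases (P : 'I_2 -> Prop) : P ord0 -> P ord_max -> forall k, P k.
Proof.
move=> P0 P1 k; have [-> //|k0] := eqVneq k ord0.
rewrite (_ : k = ord_max) //; apply: val_inj.
by case: k k0 => [[|[|]]].
Qed.

Lemma vertex_at_inj : {in cells &, injective vertex_at}.
Proof.
move=> [a b] [c d] /mem_cellsP [/= a6 b6] /mem_cellsP [/= c6 d6] /ffunP eq_v.
have := congr1 val (eq_v ord0); have := congr1 val (eq_v ord_max).
by rewrite !ffunE /= !inordK // => -> ->.
Qed.

Lemma vertex_at_onto v : exists2 u, u \in cells & vertex_at u = v.
Proof.
exists (val (v ord0), val (v ord_max)).
  by apply/mem_cellsP; split; apply: ltn_ord.
by apply/ffunP; apply: ord2_cases; rewrite ffunE /= inord_val.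
Qed.

Lemma hamming_vertex_at u v : u \in cells -> v \in cells ->
  @hamming 2 6 (vertex_at u) (vertex_at v) = adj_cell u v.
Proof.
move=> /mem_cellsP [u1 u2] /mem_cellsP [v1 v2].
rewrite /hamming cardsE -sum1_card big_mkcond /= !big_ord_recl big_ord0 addn0.
by rewrite ![_ \in _]/(vertex_at _ _ != _) !ffunE /= -!val_eqE /= !inordK //.
Qed.

Lemma elts_cells m : m \in elts ->
  [/\ cell m \in cells, cell (gmul gR m) = cell m, cell (gmul gT m) = cell m
    & adj_cell (cell m) (cell (gmul gL m))].
Proof.
have /and3P [_ _ /and3P [/allP s_cells _ _]] := elts_checks.
by move=> /s_cells /and4P [? /eqP ? /eqP ? ?].
Qed.

Lemma gens_elts g : g \in gens -> g \in elts.
Proof.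
move=> gP; have [_ /eqP gg1 _] := and3P (allP gens_base g gP).
by have [] := elts_gens gP g1_in; rewrite gg1.
Qed.

Lemma elts_darts u v : u \in cells -> v \in cells -> adj_cell u v ->
  exists2 m, m \in elts & dart m = (u, v).
Proof.
have /and3P [_ _ /and3P [_ /andP [/allP dartsP _] _]] := elts_checks.
move=> /dartsP/allP uP /uP/implyP uvP /uvP /mapP [m m_in ->].
by exists m.
Qed.

Lemma elts_edge m p : m \in elts -> p \in elts -> dart m = dart p ->
  p = m \/ p = gmul gT m.
Proof.
have /and3P [_ _ /and3P [_ /andP [_ /allP edgeP] _]] := elts_checks.
move=> m_in p_in eq_dart; move: (edgeP m m_in) (edgeP p p_in).
rewrite -eq_dart; move: (nth _ _ _) => y /orP [] /eqP m_y /orP [] /eqP p_y.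
- by left; rewrite p_y.
- by right; rewrite p_y -m_y.
- by right; rewrite m_y p_y; rewrite p_y in p_in; have [_ _ ->] := elts_gens gT_in p_in.
- by left; rewrite p_y.
Qed.

Definition lab (x : pflag) := vertex_at (cell (val x)).

Lemma cell_in (x : pflag) : cell (val x) \in cells.
Proof. by have [] := elts_cells (mem_pflag x). Qed.

Lemma lab_gL x : lab (lmul gL x) = vertex_at (dart (val x)).2.
Proof. by rewrite /lab val_lmul. Qed.

Lemma lab_gR x : lab (lmul gR x) = lab x.
Proof. by rewrite /lab val_lmul //; have [_ -> _ _] := elts_cells (mem_pflag x). Qed.

Lemma lab_gT x : lab (lmul gT x) = lab x.
Proof. by rewrite /lab val_lmul //; have [_ _ -> _] := elts_cells (mem_pflag x). Qed.

Lemma lab_adj x : @hamming 2 6 (lab x) (lab (lmul gL x)).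
Proof.
rewrite hamming_vertex_at ?cell_in // val_lmul //.
by have [] := elts_cells (mem_pflag x).
Qed.

Lemma lab_dart u v : @hamming 2 6 u v -> exists x, lab x = u /\ lab (lmul gL x) = v.
Proof.
have [a a_in <-] := vertex_at_onto u; have [b b_in <-] := vertex_at_onto v.
rewrite hamming_vertex_at // => /(elts_darts a_in b_in) [m m_in [ma mb]].
by exists (SeqSub m_in); rewrite lab_gL /lab /= ma mb.
Qed.

(** Each vertex of the graph is an end of some arc, and arcs come from flags. *)
Lemma lab_onto v : exists x, lab x = v.
Proof.
have [a /mem_cellsP [a1 a2] <-] := vertex_at_onto v.
(* any other cell in the same row will do *)
pose b := (a.1, (a.2 == 0) : nat).
have b_in : b \in cells by apply/mem_cellsP; split=> //=; case: eqP.
have ab : adj_cell a b by rewrite /adj_cell /b /= eqxx; case: a.2 => [|[]].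
have /lab_dart [x [xa _]] : @hamming 2 6 (vertex_at a) (vertex_at b).
  by rewrite hamming_vertex_at //; apply/mem_cellsP.
by exists x.
Qed.

(** There are 36 labels and 36 vertices. *)
Lemma lab_vertex (x y : flag map10) : lab x = lab y <-> vertex_of x = vertex_of y.
Proof.
apply: orbit2_separated; [exact: cheK | exact: chfK | exact: lab_gR | exact: lab_gT |].
transitivity 36; last by have [v _ _] := counts_map10; exact: esym v.
rewrite (_ : imset _ _ = [set: {ffun 'I_2 -> 'I_6}]).
  by rewrite cardsT card_ffun !card_ord.
by apply/setP => v; rewrite inE; have [z <-] := lab_onto v; rewrite imset_f.
Qed.

Lemma set2_eq (T : finType) (a b c d : T) : [set a; b] = [set c; d] ->
  a = c /\ b = d \/ a = d /\ b = c.
Proof.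
move=> /setP eq_ab; move: (eq_ab a) (eq_ab b) (eq_ab c) (eq_ab d).
rewrite !inE !eqxx ?orbT /=.
move=> /esym/orP [] /eqP -> /esym/orP [] /eqP ->; rewrite ?eqxx ?orbb; auto.
  by move=> _ /eqP ->; auto.
by move=> /eqP ->; auto.
Qed.

(** A flag and its [chf] image are the only ones with a given arc, and reversing
    the arc is the effect of [chv]; so an edge of the graph determines its four
    flags. *)
Lemma lab_edge (x y : flag map10) :
    [set lab x; lab (chv x)] = [set lab y; lab (chv y)] ->
  edge_of x = edge_of y.
Proof.
have same_dart (z w : pflag) : lab z = lab w -> lab (lmul gL z) = lab (lmul gL w) ->
    edge_of (M := map10) z = edge_of (M := map10) w.
  move=> zw; rewrite !lab_gL => zw'.
  have eq_dart : dart (val z) = dart (val w).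
    rewrite [dart (val z)]surjective_pairing [dart (val w)]surjective_pairing.
    have dart2_in (t : pflag) : (dart (val t)).2 \in cells.
      by have := cell_in (lmul gL t); rewrite val_lmul.
    by congr pair; apply: vertex_at_inj; rewrite ?dart2_in ?cell_in.
  have [/val_inj -> //|] := elts_edge (mem_pflag z) (mem_pflag w) eq_dart.
  rewrite -(val_lmul gT_in z) => /val_inj ->.
  by apply/esym; case: (orbit2_stepE (@chvK map10) (@chfK map10) z).
case/set2_eq => [[xy xy']|[xy yx]]; first exact: same_dart.
transitivity (edge_of (M := map10) (lmul gL y)).
  by apply: same_dart; rewrite ?lmulK.
by case: (orbit2_stepE (@chvK map10) (@chfK map10) y).
Qed.

Lemma embeds_map10 : embeds map10 (@hamming 2 6).
Proof.
exists lab; split.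
- exact: lab_onto.
- exact: lab_vertex.
- exact: lab_adj.
- exact: lab_dart.
- exact: lab_edge.
Qed.

(** * The automorphism group *)

Section Isog.
Import GRing.Theory.
Variable F : finFieldType.
Hypothesis cardF : #|F| = 9.

Lemma elts_mx m : m \in elts -> unit9 (det9 m.2) /\
  let: ((a, b), (c, d)) := m.2 in
    [|| unit9 b, unit9 c, unit9 (add9 a (mul9 (2, 0) d)) | m == g1].
Proof.
have /and3P [_ _ /and3P [_ _ /allP mxP]] := elts_checks.
by move=> /mxP; case: m => p [[a b] [c d]] /= /andP [].
Qed.

Lemma map_aut10_isog : map_aut map10 \isog PGL 2 F.
Proof.
have [i i2] := exists_sqrtN1 cardF.
pose E (m : gcode) := embed_mx i m.2.
pose f (x : pflag) := coset 'Z('GL_2[F])%g (GLof (E (val x))).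
pose c g := coset 'Z('GL_2[F])%g (GLof (E g)).
have Eunit (x : pflag) : E (val x) \in unitmx.
  by apply: (embed_mx_unit cardF i2); case: (elts_mx (mem_pflag x)).
have fE g x : g \in gens -> f (lmul g x) = (c g * f x)%g.
  move=> gP; rewrite /c /f -morphM ?in_norm_center //.
  apply: (coset_scale (k := embed9 i (inv9 (pivot9 (mulmx9 g.2 (val x).2))))).
  have Eg : E g \in unitmx.
    by apply: (embed_mx_unit cardF i2); case: (elts_mx (gens_elts gP)).
  rewrite GL_MxE !GLofE ?Eunit // val_lmul // /E.
  by rewrite /gmul /= /pmul9 (embed_mxZ cardF i2) (embed_mxM cardF i2).
apply: (map_aut_isog (M := map10) (G := ('GL_2[F] / 'Z('GL_2[F]))%G) (f := f)
          (a := c gL) (b := c gR) (c := c gT) (x := base)).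
- exact: regular_map10.
- by rewrite card_pflag card_PGL.
- by move=> x; rewrite mem_quotient ?inE.
- rewrite /f coset_id //; apply: (scalar_central (k := 1%R)).
  by rewrite GLofE ?Eunit // /E /= embed_mx1.
- by move=> x; split; apply: fE.
- move=> x /(coset_idr (in_norm_center _)) /(central_entries cardF i2).
  rewrite GLofE ?Eunit // !mxE /=; have [_] := elts_mx (mem_pflag x).
  case E2: (val x).2 => [[a b] [c' d]] /= not_scalar [b0 c0 ad].
  case/or4P: not_scalar => [| | | /eqP xg1]; last exact: val_inj.
  - by move/(embed9_unit cardF i2); rewrite b0 eqxx.
  - by move/(embed9_unit cardF i2); rewrite c0 eqxx.
  move/(embed9_unit cardF i2).
  rewrite (embed9D cardF) (embed9M cardF i2) (embed9_2 cardF) ad mulN1r subrr.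
  by rewrite eqxx.
Qed.
End Isog.

(* The field with 9 elements enters as an arbitrary field F of that order;
   it is not 'F_9, which denotes the prime field of characteristic 3. *)
Theorem lemma2p5 :
  exists M N : surfmap,
    [/\ regular_embedding (@hamming 2 6) M /\ nonorientable M,
        regular_embedding (@hamming 2 6) N /\ nonorientable N,
        ~ map_iso M N
      & is_petrie_dual M N /\ is_petrie_dual N M] /\
    [/\ nonorientable_genus M = 110%:Z%R /\ nonorientable_genus N = 101%:Z%R,
        has_type M 10 10 8,
        has_type N 8 10 10
      & forall F : finFieldType, #|F| = 9 ->
          map_aut M \isog PGL 2 F /\ map_aut N \isog PGL 2 F].

Proof.
have reg10 := regular_map10; have [v10 e10 f10] := counts_map10.
have [v8 e8 f8] := counts_map8.
exists map10, map8; split; split.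
- by split; [split=> //; exact: embeds_map10 | exact: nonorientable_map10].
- split; last exact: nonorientable_map8.
  by split; [exact/embeds_petrie/embeds_map10 | exact: regular_map8].
- exact: map10_not_iso_map8.
- exact: petrie_is_dual.
- by rewrite (genus_counts v10 e10 f10) (genus_counts v8 e8 f8).
- exact: has_type_map10.
- exact/has_type_petrie/has_type_map10.
- move=> F cardF; have isoM := map_aut10_isog cardF.
  by rewrite map_aut_petrie.
Qed.
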